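(* Let $d\mu$ be a probability measure on $\partial\mathbb{D}$ with Verblunsky coefficients $(\alpha_n)_{n\ge0}$, let $\zeta\in\partial\mathbb{D}$ with $\mu(\{\zeta\})=0$, let $0<\gamma<1$, and let $d\nu=(1-\gamma)\,d\mu+\gamma\,\delta_\zeta$. Suppose $\lim_{n\to\infty}\zeta^n\alpha_n=L$. Then $$\lim_{n\to\infty}\zeta^n\Delta_n(\zeta)=-2L .$$ As a result, $$\lim_{n\to\infty}\zeta^n\alpha_n(d\nu)=-\lim_{n\to\infty}\zeta^n\alpha_n(d\mu).$$
   Context: $\mathbb{D}$ is the open unit disc in $\mathbb{C}$ and $\partial\mathbb{D}$ the unit circle. For a probability measure $d\mu$ on $\partial\mathbb{D}$ with infinite support, $\Phi_n(z)$ are the monic orthogonal polynomials in $L^2(\partial\mathbb{D},d\mu)$, $\varphi_n=\Phi_n/\|\Phi_n\|_{d\mu}$ the orthonormal polynomials, $\Phi_n^*(z)=z^n\overline{\Phi_n(1/\bar z)}$ and $\varphi_n^*(z)=z^n\overline{\varphi_n(1/\bar z)}$. The Verblunsky coefficients $\alpha_n=\alpha_n(d\mu)\in\mathbb{D}$, $n\ge0$, are defined by $\Phi_{n+1}(z)=z\Phi_n(z)-\overline{\alpha_n}\Phi_n^*(z)$. Objects without the label $(d\nu)$ are associated with $d\mu$; $\alpha_n(d\nu)$ are the Verblunsky coefficients of $d\nu$. For $\zeta\in\partial\mathbb{D}$ and $0<\gamma<1$, $$\Delta_n(\zeta)=\frac{(1-|\alpha_n|^2)^{1/2}\,\overline{\varphi_{n+1}(\zeta)}\,\varphi_n^*(\zeta)}{(1-\gamma)\gamma^{-1}+K_n(\zeta,\zeta)},\qquad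 K_n(\zeta,\zeta)=\sum_{j=0}^n|\varphi_j(\zeta)|^2 .$$ It is known that $\alpha_n(d\nu)=\alpha_n(d\mu)+\Delta_n(\zeta)$ for $d\nu=(1-\gamma)d\mu+\gamma\delta_\zeta$. *)

(* Defs.v *)
From HB Require Import structures.
From mathcomp Require Import all_boot all_order all_algebra.
From mathcomp Require Import complex.
From mathcomp Require Import all_classical all_reals all_analysis.
Set Implicit Arguments.
Unset Strict Implicit.
Unset Printing Implicit Defensive.
Import Order.TTheory GRing.Theory Num.Theory.
Import numFieldNormedType.Exports.
Local Open Scope classical_set_scope.
Local Open Scope ring_scope.

(* R[i], kept folded behind its numClosedFieldType structure, so that the
   topology that every numFieldType carries (the one of its modulus) is found
   for it. Here z^* is Num.conj and the modulus `|z| is itself in Cplx R. *)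
Definition Cplx (R : realType) : numClosedFieldType := R[i].

(* A probability measure on the unit circle is encoded as a Borel probability
   measure mu on Cplx R with mu circle = 1. *)
Notation borelC R := (g_sigma_algebraType (@open (Cplx R))).

Definition circle (R : realType) : set (Cplx R) := [set z | `|z| = 1].

Definition measure_support (R : realType)
    (mu : {measure set (borelC R) -> \bar R}) : set (Cplx R) :=
  [set z | forall U : set (Cplx R), open U -> U z -> (0 < mu U)%E].

(* The polynomial form of p^*(z) = z^n (p(1/z^* ))^*. *)
Definition reversed (C : numClosedFieldType) (n : nat) (p : {poly C}) :
    {poly C} :=
  \poly_(j < n.+1) (p`_(n - j))^*.

Lemma reversedE (C : numClosedFieldType) (n : nat) (p : {poly C}) (z : C) :
  (size p <= n.+1)%N -> z != 0 ->
  (reversed n p).[z] = z ^+ n * (p.[(z^*)^-1])^*.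
Proof.
move=> sp z0; rewrite /reversed horner_poly (horner_coef_wide _ sp).
rewrite rmorph_sum mulr_sumr [LHS](reindex_inj rev_ord_inj).
apply: eq_bigr => j _ /=; have jn : (j <= n)%N by rewrite -ltnS.
rewrite subSS subKn// rmorphM rmorphXn fmorphV /= conjCK mulrCA.
by congr (_ * _); rewrite exprVn expfB_cond ?(negPf z0).
Qed.

Section opuc.
Context (R : realType).
Variable mu : {measure set (borelC R) -> \bar R}.

Definition circle_integral (f : Cplx R -> Cplx R) : Cplx R :=
  ((\int[mu]_(z in @circle R) complex.Re (f z))
   +i* (\int[mu]_(z in @circle R) complex.Im (f z)))%C.

Definition inner (p q : {poly (Cplx R)}) : Cplx R :=
  circle_integral (fun z => p.[z]^* * q.[z]).

Definition L2norm (p : {poly (Cplx R)}) : Cplx R := sqrtC (inner p p).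

(* xget 0 P is an element of P, or 0 if P is empty. When mu is a probability
   measure on the circle with infinite support, the sets P used in monic_op and
   verblunsky are singletons. *)
Definition monic_op (n : nat) : {poly (Cplx R)} :=
  xget 0 [set p : {poly (Cplx R)} | [/\ p \is monic, size p = n.+1 &
    forall q : {poly (Cplx R)}, (size q <= n)%N -> inner p q = 0]].

Definition orthonormal_op (n : nat) : {poly (Cplx R)} :=
  (L2norm (monic_op n))^-1 *: monic_op n.

Definition verblunsky (n : nat) : Cplx R :=
  xget 0 [set a : Cplx R | monic_op n.+1 =
    'X * monic_op n - a^* *: reversed n (monic_op n)].

Definition CD_kernel_diag (n : nat) (zeta : Cplx R) : Cplx R :=
  \sum_(j < n.+1) `|(orthonormal_op j).[zeta]| ^+ 2.

Definition Delta (gamma : R) (zeta : Cplx R) (n : nat) : Cplx R :=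
  sqrtC (1 - `|verblunsky n| ^+ 2) * (orthonormal_op n.+1).[zeta]^*
    * (reversed n (orthonormal_op n)).[zeta]
  / ((((1 - gamma) * gamma^-1)%:C%C : Cplx R) + CD_kernel_diag n zeta).

End opuc.

(* Main.v *)
Require Import Defs.
From HB Require Import structures.
From mathcomp Require Import all_boot all_order all_algebra.
From mathcomp Require Import complex ring zify.
From mathcomp Require Import all_classical all_reals all_analysis.
From mathcomp Require Import measurable_realfun.
Import Order.TTheory GRing.Theory Num.Theory.
Import numFieldNormedType.Exports.
Local Open Scope classical_set_scope.
Local Open Scope ring_scope.
Set Implicit Arguments.
Unset Strict Implicit.
Unset Printing Implicit Defensive.

(** Write Phi_n for the monic orthogonal polynomials of mu, h_n = ||Phi_n||^2,
   f_n = Phi_n(zeta), a_n = zeta^n alpha_n, c = (1 - gamma) / gamma and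
   K_n = sum_(j <= n) |f_j|^2 / h_j. On the circle the reversed polynomial takes
   the value zeta^n f_n^*, and since h_(n+1) = (1 - |alpha_n|^2) h_n all square
   roots in Delta_n cancel ([DeltaE]):
     zeta^n Delta_n = N_n / (c + K_n),  N_n = zeta^n f_(n+1)^* zeta^n f_n^* / h_n.

   The key point is that N_n telescopes. Expanding f_(n+2) in N_(n+1) by the
   Szego recursion, and zeta^n f_n^* in N_n by the inverse recursion, produces
   the same leading term, whence ([fluxS])
     N_(n+1) - N_n = - (a_(n+1) + a_n) |f_(n+1)|^2 / h_(n+1).
   So N_n is, up to a constant, minus the sum of the a_j + a_(j-1), which tend
   to 2 L, with weights |f_j|^2 / h_j of total K_n. If K_n tends to infinity, the
   Stolz-Cesaro argument gives N_n / (c + K_n) --> - 2 L ([flux_mean_cvg]).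

   K_n tends to infinity because mu has no atom at zeta: 1 / K_n is at most
   ||q||^2 for every q of degree at most n with q(zeta) = 1
   ([christoffel_min]), and for q = ((1 + zeta^* X) / 2)^n this norm tends to
   mu {zeta} = 0 by dominated convergence ([inner_peakX_cvg0]).

   For the second limit one needs alpha_n(nu) = alpha_n(mu) + Delta_n
   ([point_mass_verblunsky]). The inner product of nu is
   (1 - gamma) <p, q>_mu + gamma p(zeta)^* q(zeta), so the orthogonal
   polynomials of nu are Phi_n - f_n / (c + K_(n-1)) K_(n-1)(., zeta)
   ([point_mass_op]); evaluating at 0, where Phi_(n+1) takes the value
   - alpha_n^*, gives the formula.

   The algebra is carried out for an abstract positive definite form on
   polynomials that is invariant under multiplication by X, which covers mu
   and nu at once. *)

(** * Inner products on polynomials for which multiplication by X is isometric *)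

(** What the orthogonal polynomial theory uses of the L^2 inner product of a
   measure on the circle with infinite support: antilinear in the first
   argument, positive definite, and isometric for multiplication by X because
   |z| = 1. *)
Record circle_form (C : numClosedFieldType) (B : {poly C} -> {poly C} -> C) :
    Prop := CircleForm {
  form_linear : forall p a q r, B p (a *: q + r) = a * B p q + B p r;
  form_conj : forall p q, B q p = (B p q)^*;
  form_gt0 : forall p, p != 0 -> 0 < B p p;
  form_mulX : forall p q, B ('X * p) ('X * q) = B p q }.

Definition is_monic_op (C : numClosedFieldType) (B : {poly C} -> {poly C} -> C)
    (n : nat) (p : {poly C}) : Prop :=
  [/\ p \is monic, size p = n.+1 &
    forall q : {poly C}, (size q <= n)%N -> B p q = 0].

Section Form.
Variables (C : numClosedFieldType) (B : {poly C} -> {poly C} -> C).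
Hypothesis BP : circle_form B.
Implicit Types p q r : {poly C}.

Lemma form0r p : B p 0 = 0.
Proof.
have := form_linear BP p 1 0 0; rewrite scaler0 addr0 mul1r.
by move/eqP; rewrite eq_sym -subr_eq0 addrK => /eqP.
Qed.

Lemma formDr p q r : B p (q + r) = B p q + B p r.
Proof. by have := form_linear BP p 1 q r; rewrite scale1r mul1r. Qed.

Lemma formZr p a q : B p (a *: q) = a * B p q.
Proof. by have := form_linear BP p a q 0; rewrite form0r !addr0. Qed.

Lemma formBr p q r : B p (q - r) = B p q - B p r.
Proof. by rewrite formDr -scaleN1r formZr mulN1r. Qed.

Lemma form_sumr p I (s : seq I) (P : pred I) F :
  B p (\sum_(i <- s | P i) F i) = \sum_(i <- s | P i) B p (F i).
Proof. exact: (big_morph (B p) (formDr p) (form0r p)). Qed.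

Lemma formDl p q r : B (q + r) p = B q p + B r p.
Proof. by rewrite (form_conj BP) formDr rmorphD/= -!(form_conj BP). Qed.

Lemma formZl p a q : B (a *: q) p = a^* * B q p.
Proof. by rewrite (form_conj BP) formZr rmorphM/= -!(form_conj BP). Qed.

Lemma formBl p q r : B (q - r) p = B q p - B r p.
Proof. by rewrite (form_conj BP) formBr rmorphB/= -!(form_conj BP). Qed.

Lemma form_ge0 p : 0 <= B p p.
Proof.
have [->|/(form_gt0 BP)/ltW//] := eqVneq p 0.
by rewrite form0r.
Qed.

Lemma form_eq0 p : B p p = 0 -> p = 0.
Proof.
move=> e; apply/eqP; apply: contraT => /(form_gt0 BP).
by rewrite e ltxx.
Qed.

Lemma form_Toeplitz k i j : B 'X^(k + i) 'X^(k + j) = B 'X^i 'X^j.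
Proof.
by elim: k => [//|k IH]; rewrite !addSn !exprS (form_mulX BP).
Qed.

Lemma form_XnE i j k l : (i + l = k + j)%N -> B 'X^i 'X^j = B 'X^k 'X^l.
Proof.
wlog ik : i j k l / (i <= k)%N => [H e|e].
  by case/orP: (leq_total i k) => ?; [|symmetry]; apply: H.
have -> : k = (k - i + i)%N by lia.
have -> : l = (k - i + j)%N by lia.
by rewrite form_Toeplitz.
Qed.

Lemma form_coef p q n : (size q <= n)%N ->
  B p q = \sum_(i < n) q`_i * B p 'X^i.
Proof.
move=> sq; rewrite -{1}(coefK q) poly_def form_sumr.
under eq_bigr do rewrite formZr.
rewrite (big_ord_widen n (fun i => q`_i * B p 'X^i) sq) big_mkcond/=.
apply: eq_bigr => i _; case: ifPn => //; rewrite -leqNgt => /leq_sizeP ->//.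
by rewrite mul0r.
Qed.

Lemma size_reversed n p : (size (reversed n p) <= n.+1)%N.
Proof. exact: size_poly. Qed.

Lemma coef_reversed n p i : (i <= n)%N -> (reversed n p)`_i = (p`_(n - i))^*.
Proof. by move=> iN; rewrite coef_poly ltnS iN. Qed.

(** On the circle p^* = z^n conj p, so reversal preserves moduli and conjugates
   the inner product. Algebraically, the Gram matrix of the monomials is
   Toeplitz, hence unchanged by reversing indices and transposing. *)
Lemma form_reversed n p q : (size p <= n.+1)%N -> (size q <= n.+1)%N ->
  B (reversed n p) (reversed n q) = B q p.
Proof.
move=> sp sq; rewrite (form_coef _ (size_reversed n q)) (form_coef q sp).
under eq_bigr => i _ do rewrite (form_conj BP) (form_coef _ (size_reversed n p)).
under [RHS]eq_bigr => i _ do rewrite (form_conj BP) (form_coef _ sq).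
under eq_bigr => i _ do rewrite rmorph_sum mulr_sumr.
under [RHS]eq_bigr => i _ do rewrite rmorph_sum mulr_sumr.
rewrite exchange_big/= (reindex_inj rev_ord_inj); apply: eq_bigr => i _.
rewrite (reindex_inj rev_ord_inj); apply: eq_bigr => j _ /=.
have iN : (i <= n)%N by rewrite -ltnS.
have jN : (j <= n)%N by rewrite -ltnS.
rewrite !subSS !rmorphM/= !coef_reversed ?leq_subr// conjCK.
rewrite !subKn// mulrCA; congr (_ * (_ * _)).
rewrite -!(form_conj BP); apply: form_XnE.
by lia.
Qed.

Lemma size_monicB n p q : p \is monic -> q \is monic ->
  size p = n.+1 -> size q = n.+1 -> (size (p - q)%R <= n)%N.
Proof.
move=> pm qm sp sq; apply/leq_sizeP => j.
rewrite leq_eqVlt coefB => /predU1P[<-|jn].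
  by move: (monicP pm) (monicP qm); rewrite !lead_coefE sp sq => -> ->; rewrite subrr.
by rewrite !nth_default ?subrr ?sp ?sq.
Qed.

Lemma monic_op_unique n p q : is_monic_op B n p -> is_monic_op B n q -> p = q.
Proof.
move=> [pm sp po] [qm sq qo]; apply/eqP; rewrite -subr_eq0; apply/eqP.
have s := size_monicB pm qm sp sq.
by apply: form_eq0; rewrite formBl po// qo// subrr.
Qed.

Lemma form_mulX_Xn n p k : is_monic_op B n p -> (0 < k <= n)%N ->
  B ('X * p) 'X^k = 0.
Proof.
move=> [_ _ po] /andP[k0 kn]; rewrite -(prednK k0) exprS (form_mulX BP) po//.
by rewrite size_polyXn prednK.
Qed.

(** Reversal turns orthogonality to 1, X, ..., X^(n-1) into orthogonality to X,
   ..., X^n, so only the constant coefficient of q contributes. *)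
Lemma form_reversed_op n p q : is_monic_op B n p -> (size q <= n.+1)%N ->
  B (reversed n p) q = (q`_0) * B p p.
Proof.
move=> [pm sp po] sq.
have eq : reversed n (reversed n q) = q.
  apply/polyP => i; have [iN|iN] := leqP i n.
    by rewrite !coef_reversed ?leq_subr// subKn// conjCK.
  by rewrite !nth_default// (leq_trans _ iN)// size_reversed.
rewrite -eq form_reversed ?sp ?size_reversed// eq.
have : (size (reversed n q - (q`_0)^* *: p)%R <= n)%N.
  apply/leq_sizeP => j; rewrite leq_eqVlt coefB coefZ => /predU1P[<-|jn].
    move/monicP: pm; rewrite lead_coefE sp/= => ->.
    by rewrite coef_reversed// subnn mulr1 subrr.
  have -> : p`_j = 0 by rewrite nth_default ?sp.
  by rewrite mulr0 subr0 nth_default// (leq_trans _ jn)// size_reversed.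
move=> /po; rewrite formBr formZr => /eqP; rewrite subr_eq0 => /eqP e.
by rewrite (form_conj BP) e rmorphM/= conjCK -(form_conj BP).
Qed.

(** X Phi_n and Phi_n^* are both orthogonal to X, ..., X^n; the coefficient a is
   chosen to make the difference orthogonal to 1 as well. This gives at once the
   existence of the next orthogonal polynomial and the Szego recursion. *)
Lemma szego_step n p : is_monic_op B n p ->
  exists a, is_monic_op B n.+1 ('X * p - a^* *: reversed n p).
Proof.
move=> pP; have [pm sp po] := pP.
exists ((B ('X * p) 1) / B p p).
set a := _ / _; have s' : (size (a^* *: reversed n p)%R < size ('X * p)%R)%N.
  rewrite mulrC size_mulX ?monic_neq0// sp ltnS.
  by rewrite (leq_trans (size_scale_leq _ _))// size_reversed.
split.
- by apply/monicP; rewrite lead_coefDl ?size_polyN// lead_coefM lead_coefX mul1r (monicP pm).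
- by rewrite size_polyDl ?size_polyN// mulrC size_mulX ?monic_neq0// sp.
move=> q sq; rewrite formBl formZl conjCK form_reversed_op// mulrCA mulfVK; last first.
  by rewrite gt_eqF// form_gt0// monic_neq0.
rewrite (form_coef _ sq) big_ord_recl/= big1 ?addr0 ?expr0 ?subrr// => i _.
by rewrite (form_mulX_Xn pP) ?mulr0//= /bump leq0n add1n.
Qed.

Lemma monic_op0 : is_monic_op B 0 1.
Proof.
split; rewrite ?monic1 ?size_poly1// => q; rewrite leqn0 size_poly_eq0 => /eqP ->.
exact: form0r.
Qed.

Lemma exists_monic_op n : exists p, is_monic_op B n p.
Proof.
elim: n => [|n [p /szego_step[a]]]; first by exists 1; exact: monic_op0.
by move=> ?; eexists; eassumption.
Qed.
End Form.

(** * Szego recursion, norms and the Christoffel-Darboux kernel *)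

Definition szego_system (C : numClosedFieldType) (B : {poly C} -> {poly C} -> C)
    (Phi : nat -> {poly C}) (al : nat -> C) : Prop :=
  forall n, is_monic_op B n (Phi n) /\
    Phi n.+1 = 'X * Phi n - (al n)^* *: reversed n (Phi n).

Section System.
Variables (C : numClosedFieldType) (B : {poly C} -> {poly C} -> C).
Hypothesis BP : circle_form B.
Variables (Phi : nat -> {poly C}) (al : nat -> C).
Hypothesis PhiP : szego_system B Phi al.

Definition opnorm2 n := B (Phi n) (Phi n).
Local Notation h := opnorm2.

Lemma opnorm2_gt0 n : 0 < h n.
Proof. by apply: (form_gt0 BP); case: (PhiP n).1 => /monic_neq0. Qed.

Lemma opnorm2_neq0 n : h n != 0.
Proof. by rewrite gt_eqF// opnorm2_gt0. Qed.

Lemma opnorm2_conj n : (h n)^* = h n.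
Proof. by rewrite -(form_conj BP). Qed.

Lemma size_op n : size (Phi n) = n.+1.
Proof. by case: (PhiP n).1. Qed.

Lemma op_orth n (q : {poly C}) : (size q <= n)%N -> B (Phi n) q = 0.
Proof. by case: (PhiP n).1 => _ _; apply. Qed.

(** Pythagoras for X Phi_n = Phi_(n+1) + alpha_n^* Phi_n^*, where the two summands
   are orthogonal and Phi_n^* has the norm of Phi_n. *)
Lemma opnorm2S n : h n.+1 = (1 - `|al n| ^+ 2) * h n.
Proof.
have E : 'X * Phi n = Phi n.+1 + (al n)^* *: reversed n (Phi n).
  by rewrite (PhiP n).2 subrK.
have O : B (Phi n.+1) (reversed n (Phi n)) = 0.
  by apply: op_orth; exact: size_reversed.
have := form_mulX BP (Phi n) (Phi n).
rewrite E (formDr BP) !(formDl BP) !(formZr BP) !(formZl BP) O.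
rewrite (form_conj BP (Phi n.+1) (reversed n (Phi n))) O rmorph0 !mulr0 addr0 add0r.
rewrite (form_reversed BP) ?size_op// conjCK normCK => e.
by rewrite mulrBl mul1r {1}/opnorm2 -[X in X - _]e /opnorm2; ring.
Qed.

Lemma onem_verblunsky_neq0 n : 1 - `|al n| ^+ 2 != 0.
Proof.
by have := opnorm2_neq0 n.+1; rewrite opnorm2S mulf_eq0 negb_or => /andP[].
Qed.

(** The constant coefficient of Phi_n^* is the conjugate leading coefficient of
   Phi_n, that is 1. This makes the Verblunsky coefficient readable from the
   orthogonal polynomial alone. *)
Lemma op_at0 n : (Phi n.+1).[0] = - (al n)^*.
Proof.
have [/monicP pm sp _] := (PhiP n).1.
rewrite (PhiP n).2 hornerD hornerN hornerZ hornerM hornerX mul0r horner_coef0.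
rewrite coef_reversed// subn0.
by move: pm; rewrite lead_coefE sp/= => ->; rewrite rmorph1 mulr1 ?(mul0r, sub0r, add0r).
Qed.

Variable z : C.
Hypothesis z1 : `|z| = 1.
Local Notation f n := ((Phi n).[z]).
Local Notation g n := (z ^+ n * ((Phi n).[z])^*).

Lemma circle_conj : z * z^* = 1.
Proof. by rewrite -normCK z1 expr1n. Qed.

Lemma circle_neq0 : z != 0.
Proof. by rewrite -normr_eq0 z1 oner_neq0. Qed.

Lemma reversed_circle n (p : {poly C}) : (size p <= n.+1)%N ->
  (reversed n p).[z] = z ^+ n * (p.[z])^*.
Proof.
move=> sp; rewrite reversedE ?circle_neq0//; congr (_ * (p.[_])^*).
have zc0 : z^* != 0 by rewrite conjC_eq0 circle_neq0.
by rewrite -[RHS]mulr1 -(mulfV zc0) mulrA circle_conj mul1r.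
Qed.

Lemma op_circleS n : f n.+1 = z * f n - (al n)^* * g n.
Proof.
by rewrite (PhiP n).2 hornerD hornerN hornerZ hornerM hornerX reversed_circle// size_op.
Qed.

(** The inverse Szego recursion, which expresses Phi_n^* through degree n + 1,
   evaluated at z. *)
Lemma op_circle_inv n : g n.+1 + al n * f n.+1 = (1 - `|al n| ^+ 2) * g n.
Proof.
rewrite op_circleS rmorphB !rmorphM rmorphXn /= !conjCK normCK exprS.
have e : z ^+ n * z^* ^+ n = 1 by rewrite -exprMn circle_conj expr1n.
transitivity ((z * z^*) * z ^+ n * (f n)^* - z * al n * f n * (z ^+ n * z^* ^+ n)
  + al n * (z * f n) - al n * (al n)^* * (z ^+ n * (f n)^*)); first by ring.
by rewrite e circle_conj; ring.
Qed.

(** The Christoffel-Darboux kernel X |-> K_(n-1)(X, z), with n terms. *)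
Definition kernel n := \sum_(j < n) ((f j)^* / h j) *: Phi j.
Definition kernel_diag n := \sum_(j < n) `|f j| ^+ 2 / h j.

Lemma kernel_diagE n : (kernel n).[z] = kernel_diag n.
Proof.
rewrite /kernel horner_sum; apply: eq_bigr => j _.
by rewrite hornerZ normCK; ring.
Qed.

Lemma size_kernel n : (size (kernel n) <= n)%N.
Proof.
apply: (leq_trans (size_sum _ _ _)); apply/bigmax_leqP => j _.
by rewrite (leq_trans (size_scale_leq _ _))// size_op.
Qed.

(** Induction on n: split off the multiple of the top orthogonal polynomial; both
   cross terms vanish by orthogonality. *)
Lemma kernel_reproducing n (q : {poly C}) : (size q <= n)%N -> B (kernel n) q = q.[z].
Proof.
elim: n q => [|n IH] q sq.
  by move: sq; rewrite leqn0 size_poly_eq0 => /eqP ->; rewrite (form0r BP) horner0.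
have [pm sp po] := (PhiP n).1.
set r := (q - q`_n *: Phi n)%R.
have sr : (size r <= n)%N.
  apply/leq_sizeP => j; rewrite leq_eqVlt coefB coefZ => /predU1P[<-|jn].
    by move/monicP: pm; rewrite lead_coefE sp/= => ->; rewrite mulr1 subrr.
  by rewrite [(Phi n)`_j]nth_default ?sp// nth_default ?mulr0 ?subr0// (leq_trans sq).
have : q = q`_n *: Phi n + r by rewrite addrC subrK.
move: sr; clearbody r; move: (q`_n) => a sr ->.
rewrite [kernel n.+1]big_ord_recr/= -/(kernel n) (formDl BP) !(formDr BP).
have e : B (kernel n) (Phi n) = 0.
  by rewrite (form_conj BP (Phi n)) po ?size_kernel// rmorph0.
rewrite (IH _ sr) (formZr BP (kernel n)) e !(formZl BP) (po _ sr) !mulr0 add0r addr0.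
rewrite hornerD hornerZ (formZr BP) -/(h n) rmorphM fmorphV /= conjCK opnorm2_conj.
by rewrite addrC; congr (_ + _); field; exact: opnorm2_neq0.
Qed.

Lemma kernel_diag_ge0 n : 0 <= kernel_diag n.
Proof.
by apply: sumr_ge0 => j _; rewrite divr_ge0 ?exprn_ge0// ltW ?opnorm2_gt0.
Qed.

Lemma op0 : Phi 0%N = 1.
Proof. exact: (monic_op_unique BP (PhiP 0).1 (monic_op0 BP)). Qed.

Lemma kernel_diag_gt0 n : 0 < kernel_diag n.+1.
Proof.
rewrite /kernel_diag big_ord_recl/= op0 hornerC normr1 expr1n.
rewrite ltr_wpDr ?divr_gt0 ?opnorm2_gt0// sumr_ge0// => j _.
by rewrite divr_ge0 ?exprn_ge0// ltW ?opnorm2_gt0.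
Qed.

(** Positivity of the squared norm of q - k / K, where k is the kernel and K its
   value at z; that squared norm is ||q||^2 - 1 / K by the reproducing property. *)
Lemma christoffel_min n (q : {poly C}) : (size q <= n.+1)%N -> q.[z] = 1 ->
  (kernel_diag n.+1)^-1 <= B q q.
Proof.
move=> sq qz; set K := kernel_diag n.+1; set k := kernel n.+1.
have K0 : K != 0 by rewrite gt_eqF ?kernel_diag_gt0.
have Kr : K^* = K by apply: CrealP; rewrite ger0_real// kernel_diag_ge0.
have := form_ge0 BP (q - K^-1 *: k).
have kq : B k q = 1 by rewrite kernel_reproducing.
have kk : B k k = K by rewrite kernel_reproducing ?kernel_diagE// size_kernel.
have qk : B q k = 1 by rewrite (form_conj BP k) kq rmorph1.
rewrite (formBr BP) !(formBl BP) (formZr BP) !(formZl BP) (formZr BP).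
rewrite fmorphV/= Kr kq kk qk mulVf// !mulr1 subrr subr0.
by rewrite subr_ge0.
Qed.

(** Conjugated, the kernel at 0 is the reversed polynomial at z, up to 1 / h_n: by the inverse
   recursion, adding the next term of the sum moves g_n / h_n to
   g_(n+1) / h_(n+1), where g_n = z^n f_n^*. *)
Lemma kernel_at0 n : ((kernel n.+1).[0])^* = g n / h n.
Proof.
elim: n => [|n IH].
  rewrite /kernel big_ord_recr big_ord0/= add0r op0 hornerZ !hornerC expr0 mul1r mulr1.
  by rewrite rmorphM fmorphV/= opnorm2_conj conjCK rmorph1.
rewrite /kernel big_ord_recr/= hornerD -/(kernel n.+1) rmorphD/= IH hornerZ op_at0.
rewrite !rmorphM rmorphN fmorphV/= opnorm2_conj !conjCK.
have E : al n * f n.+1 = (1 - `|al n| ^+ 2) * g n - g n.+1.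
  by rewrite -op_circle_inv; ring.
transitivity (g n / h n - (al n * f n.+1) / h n.+1); first by ring.
rewrite E opnorm2S; have := onem_verblunsky_neq0 n; have := opnorm2_neq0 n.
by move=> *; field; apply/andP.
Qed.

(** The numerator of z^n Delta_n(z), free of square roots. *)
Definition flux n := z ^+ n * (f n.+1)^* * g n / h n.

(** With f_(n+2) expanded by the Szego recursion and g_n by its inverse, both
   sides contain the term z^n f_(n+1)^* g_(n+1) / h_(n+1); it cancels and only
   multiples of |f_(n+1)|^2 / h_(n+1) remain. *)
Lemma fluxS n : flux n.+1 = flux n -
  (z ^+ n.+1 * al n.+1 + z ^+ n * al n) * (`|f n.+1| ^+ 2 / h n.+1).
Proof.
rewrite /flux (op_circleS n.+1).
rewrite -(mulrA _ (g n)).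
have -> : g n / h n = (g n.+1 + al n * f n.+1) / h n.+1.
  rewrite op_circle_inv opnorm2S; have := onem_verblunsky_neq0 n; have := opnorm2_neq0 n.
  by move=> *; field; apply/andP.
have -> : z ^+ n.+1 * (z * f n.+1 - (al n.+1)^* * g n.+1)^* =
    z ^+ n * (f n.+1)^* - al n.+1 * f n.+1.
  rewrite rmorphB !rmorphM rmorphXn /= !conjCK.
  have e : z ^+ n.+1 * z^* ^+ n.+1 = 1 by rewrite -exprMn circle_conj expr1n.
  transitivity ((z * z^*) * z ^+ n * (f n.+1)^* -
    al n.+1 * f n.+1 * (z ^+ n.+1 * z^* ^+ n.+1)); first by rewrite exprS; ring.
  by rewrite e circle_conj; ring.
by rewrite normCK -mulrA -mulrA; ring.
Qed.
End System.

(** * Adding a point mass *)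

Section PointMass.
Variables (C : numClosedFieldType) (B : {poly C} -> {poly C} -> C).
Hypothesis BP : circle_form B.
Variables (z gamma : C).
Hypotheses (z1 : `|z| = 1) (g0 : 0 < gamma) (g1 : gamma < 1).

Definition point_mass_form p q :=
  (1 - gamma) * B p q + gamma * ((p.[z])^* * q.[z]).

Lemma circle_form_point_mass : circle_form point_mass_form.
Proof.
have gr : gamma^* = gamma by apply: CrealP; rewrite gtr0_real.
rewrite /point_mass_form; split.
- by move=> p a q r; rewrite (form_linear BP) hornerD hornerZ; ring.
- move=> p q; rewrite (form_conj BP) rmorphD !rmorphM rmorphB rmorph1 /= conjCK gr.
  by ring.
- move=> p p0; rewrite ltr_wpDr//.
    by apply: mulr_ge0; [exact: ltW|rewrite mulrC -normCK exprn_ge0].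
  by rewrite mulr_gt0 ?subr_gt0// (form_gt0 BP).
- move=> p q; rewrite (form_mulX BP) !hornerM hornerX rmorphM/=.
  congr (_ + _ * _).
  by rewrite mulrACA (mulrC z^*) (circle_conj z1) mul1r.
Qed.

Variables (Phi : nat -> {poly C}) (al : nat -> C).
Hypothesis PhiP : szego_system B Phi al.
Local Notation h n := (opnorm2 B Phi n).
Local Notation K n := (kernel_diag B Phi z n).
Local Notation c := ((1 - gamma) / gamma).

Lemma point_mass_denom_gt0 n : 0 < c + K n.
Proof.
by rewrite ltr_wpDr ?(kernel_diag_ge0 BP PhiP)// divr_gt0// subr_gt0.
Qed.

(** Against q of degree less than n the kernel contributes a multiple of q(z), by
   the reproducing property, as does the point mass; the coefficient is the one
   for which the two cancel. *)
Lemma point_mass_op n : is_monic_op point_mass_form n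
  (Phi n - ((Phi n).[z] / (c + K n)) *: kernel B Phi z n).
Proof.
have [pm sp po] := (PhiP n).1.
have sk := size_kernel PhiP z n.
have lt : (size (- (((Phi n).[z] / (c + K n)) *: kernel B Phi z n))%R < size (Phi n))%N.
  by rewrite size_polyN sp ltnS (leq_trans (size_scale_leq _ _)).
split.
- by apply/monicP; rewrite lead_coefDl// (monicP pm).
- by rewrite size_polyDl.
move=> q sq; rewrite /point_mass_form (formBl BP) po// (formZl BP).
rewrite (kernel_reproducing BP PhiP)// hornerD hornerN hornerZ kernel_diagE.
set fz := (Phi n).[z]; have D0 := point_mass_denom_gt0 n.
set t := fz / _; have cr : c^* = c.
  by apply: CrealP; rewrite ger0_real// divr_ge0 ?subr_ge0// ltW.
have -> : fz - t * K n = c * t.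
  by rewrite -(divfK (lt0r_neq0 D0) fz) -/t; ring.
have -> : (c * t)^* = c * t^* by rewrite [LHS]rmorphM [X in X * _]cr.
clearbody t; rewrite sub0r; field.
exact: lt0r_neq0.
Qed.

(** Compare the values at 0 of the two monic orthogonal polynomials of degree
   n + 1; the value of the kernel there is [kernel_at0]. *)
Lemma point_mass_verblunsky Psi be : szego_system point_mass_form Psi be ->
  forall n, be n = al n +
    ((Phi n.+1).[z])^* * (z ^+ n * ((Phi n).[z])^*) / (h n * (c + K n.+1)).
Proof.
move=> PsiP n; rewrite -[be n]conjCK.
have -> : (be n)^* = - (Psi n.+1).[0] by rewrite (op_at0 PsiP) opprK.
rewrite (monic_op_unique circle_form_point_mass (PsiP n.+1).1 (point_mass_op n.+1)).
have D0 := point_mass_denom_gt0 n.+1.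
have Dr : (c + K n.+1)^* = c + K n.+1 by apply: CrealP; rewrite gtr0_real.
rewrite hornerD hornerN hornerZ (op_at0 PhiP) opprD !opprK rmorphD/= conjCK.
rewrite !rmorphM/= fmorphV/= Dr (kernel_at0 BP PhiP z1).
congr (_ + _); move: (lt0r_neq0 D0) (opnorm2_neq0 BP PhiP n) => {D0 Dr}.
by move: (c + K n.+1) (h n) => d y d0 y0; field; apply/andP.
Qed.
End PointMass.

(** * Weighted means and the limit of the numerators *)

Section Toeplitz.
Variable C : numFieldType.
Implicit Types a k D : nat -> C.

(** Stolz-Cesaro. The weights are only nonnegative, because orthogonal
   polynomials may be small at a point, and D only dominates their partial sums,
   to leave room for the constant c in c + K_n. *)
Lemma weighted_mean_cvg0 a k D : (forall n, 0 <= k n) -> (forall n, 0 < D n) ->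
  (forall n, \sum_(j < n.+1) k j <= D n) -> (D n)^-1 @[n --> \oo] --> (0 : C) ->
  a n @[n --> \oo] --> (0 : C) ->
  (\sum_(j < n.+1) a j * k j) / D n @[n --> \oo] --> (0 : C).
Proof.
move=> k0 D0 kD Dcvg acvg; apply/cvgr0Pnorm_lt => e e0.
have e2 : 0 < e / 2 by rewrite divr_gt0.
(* the terms before N contribute at most A / D n, the others at most e / 2 *)
have [N _ aN] := (cvgr0Pnorm_lt _).1 acvg _ e2.
pose A := \sum_(j < N) `|a j| * k j.
have A0 : 0 <= A by apply: sumr_ge0 => j _; rewrite mulr_ge0.
have eA : 0 < e / 2 / (A + 1) by rewrite divr_gt0// ltr_wpDl.
have {}Dcvg := (cvgr0Pnorm_lt _).1 Dcvg _ eA.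
near=> n.
have Dn : (D n)^-1 < e / 2 / (A + 1).
  have : `|(D n)^-1| < e / 2 / (A + 1) by near: n; exact: Dcvg.
  by rewrite gtr0_norm// invr_gt0.
rewrite normrM normfV (gtr0_norm (D0 n)) ltr_pdivrMr//.
have : `|\sum_(j < n.+1) a j * k j| <= A + e / 2 * D n.
  apply: (le_trans (ler_norm_sum _ _ _)).
  have Nn : (N <= n.+1)%N by near: n; exists N => // m /= /leqW.
  rewrite -(big_mkord xpredT (fun j => `|a j * k j|)) (big_cat_nat _ Nn)//=.
  apply: lerD.
    rewrite big_mkord; apply: ler_sum => j _.
    by rewrite normrM (ger0_norm (k0 j)).
  apply: (@le_trans _ _ (\sum_(N <= j < n.+1) e / 2 * k j)).
    rewrite !big_nat; apply: ler_sum => j /andP[Nj _].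
    by rewrite normrM (ger0_norm (k0 j)) ler_wpM2r// ltW// aN.
  rewrite -mulr_sumr ler_wpM2l ?(ltW e2)// (le_trans _ (kD n))//.
  by rewrite -(big_mkord xpredT k) [leRHS](big_cat_nat _ Nn)//= lerDr sumr_ge0.
move=> /le_lt_trans; apply.
rewrite [e in ltRHS](splitr e) mulrDl ltrD2r.
move: Dn; rewrite ltr_pdivlMr ?ltr_wpDl// mulrC ltr_pdivrMr//.
by apply: le_lt_trans; rewrite lerDl.
Unshelve. all: by end_near.
Qed.
End Toeplitz.

Section FluxLimit.
Variables (C : numClosedFieldType) (B : {poly C} -> {poly C} -> C).
Hypothesis BP : circle_form B.
Variables (Phi : nat -> {poly C}) (al : nat -> C).
Hypothesis PhiP : szego_system B Phi al.
Variables (z c L : C).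
Hypotheses (z1 : `|z| = 1) (c0 : 0 < c).
Local Notation K n := (kernel_diag B Phi z n).
Local Notation flux := (flux B Phi z).

(** Summing [fluxS], the sequence flux n + 2 L (c + K n.+1) is a constant plus a
   weighted sum of 2 L - (a_j + a_(j-1)), which tends to 0. *)
Lemma flux_mean_cvg : (K n.+1)^-1 @[n --> \oo] --> (0 : C) ->
  z ^+ n * al n @[n --> \oo] --> L ->
  flux n / (c + K n.+1) @[n --> \oo] --> - 2 * L.
Proof.
move=> Kcvg acvg; pose a n := z ^+ n * al n; pose D n := c + K n.+1.
pose k j := `|(Phi j).[z]| ^+ 2 / opnorm2 B Phi j.
have k0 j : 0 <= k j by rewrite divr_ge0 ?exprn_ge0// ltW// (opnorm2_gt0 BP PhiP).
have KD n : K n.+1 <= D n by rewrite lerDr ltW.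
have D0 n : 0 < D n by apply: lt_le_trans (KD n); exact: kernel_diag_gt0 PhiP _ _.
have Dcvg : (D n)^-1 @[n --> \oo] --> (0 : C).
  apply/cvgr0Pnorm_lt => e e0; have [N _ HN] := (cvgr0Pnorm_lt _).1 Kcvg _ e0.
  exists N => // n /HN /=; apply: le_lt_trans.
  have Kn := kernel_diag_gt0 BP PhiP z n.
  by rewrite !gtr0_norm ?invr_gt0// lef_pV2 ?KD// qualifE/= D0.
(* b 0 has no difference of flux behind it (a 0.-1 is a 0); the last term of E
   compensates for it *)
pose b j := 2 * L - (a j + a j.-1).
have bcvg : b n @[n --> \oo] --> (0 : C).
  have aS : a n.+1 @[n --> \oo] --> L by rewrite (cvg_shiftS a).
  have aa : a n.+1 + a n @[n --> \oo] --> L + L by exact: cvgD aS acvg.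
  have bS : 2 * L - (a n.+1 + a n) @[n --> \oo] --> 2 * L - (L + L).
    by apply: cvgB; [exact: cvg_cst|exact: aa].
  rewrite -(cvg_shiftS b).
  have e : 2 * L - (L + L) = 0 by ring.
  by rewrite e in bS.
pose E := flux 0%N + 2 * L * c + 2 * a 0%N * k 0%N.
have fluxE n : flux n = E + \sum_(j < n.+1) b j * k j - 2 * L * D n.
  elim: n => [|n IH].
    by rewrite /E /D /kernel_diag !big_ord_recr !big_ord0 /= /b /k; ring.
  rewrite (fluxS BP PhiP z1) IH [in RHS]big_ord_recr /D /kernel_diag.
  by rewrite [in RHS](big_ord_recr n.+1)/= /b /k /a; ring.
have -> : - 2 * L = E * 0 + 0 + (- 2 * L) by rewrite mulr0 !add0r.
have -> : (fun n => flux n / D n) =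
    (fun n => E * (D n)^-1 + (\sum_(j < n.+1) b j * k j) / D n + (- 2 * L)).
  apply/funext => n; rewrite fluxE; have := lt0r_neq0 (D0 n).
  by move: (D n) (\sum_(_ < _) _) => d s d0; field.
have wcvg := weighted_mean_cvg0 k0 D0 KD Dcvg bcvg.
have Ecvg : E * (D n)^-1 @[n --> \oo] --> E * 0.
  by apply: cvgM; [exact: cvg_cst|exact: Dcvg].
have EW : E * (D n)^-1 + (\sum_(j < n.+1) b j * k j) / D n @[n --> \oo] --> E * 0 + 0.
  by apply: cvgD; [exact: Ecvg|exact: wcvg].
by apply: cvgD; [exact: EW|exact: cvg_cst].
Qed.
End FluxLimit.

(** * Continuous functions on the complex plane and Borel sets *)

Section Analysis.
Variable R : realType.
Implicit Types f g : Cplx R -> Cplx R.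
Local Notation Re := (@complex.Re R).
Local Notation Im := (@complex.Im R).
Local Notation circle := (@circle R).

Lemma continuous_Re : continuous (Re : Cplx R -> R).
Proof.
move=> x; apply/(@cvgrPdist_lt _ _ _ (nbhs x) (nbhs_filter x)) => e e0.
have ec0 : 0 < (e%:C%C : Cplx R) by rewrite ltcR.
have := nbhsx_ballx x _ ec0.
apply: filterS => y xy; rewrite -ltcR; apply: le_lt_trans xy.
have := normc_ge_Re (x - y : Cplx R).
by case: x y => [a b] [c d].
Qed.

(** Lets integrals of imaginary parts be treated as integrals of real parts. *)
Lemma Im_Re (x : Cplx R) : Im x = Re (- 'i%C * x).
Proof. by case: x => a b /=; rewrite !oppr0 mul0r sub0r mulN1r opprK. Qed.

Lemma continuous_conj : continuous (fun z : Cplx R => z^*).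
Proof.
move=> x; apply/(@cvgrPdist_lt _ _ _ (nbhs x) (nbhs_filter x)) => e e0.
have := nbhsx_ballx x _ e0.
by apply: filterS => y; rewrite /= -rmorphB norm_conjC.
Qed.

(** Closed under sums, products and conjugation, hence contains the integrands
   p(z)^* q(z). The bound, which gives integrability, is on the circle only because
   polynomials are unbounded on the plane. *)
Definition bounded_continuous f :=
  continuous f /\ exists M : R, forall z, circle z -> `|f z| <= M%:C%C.

Lemma bounded_continuous_cst a : bounded_continuous (fun=> a).
Proof.
split; first by move=> z; exact: cst_continuous.
exists (Re `|a|) => z _.
by rewrite RRe_real// normr_real.
Qed.

Lemma bounded_continuous_id : bounded_continuous id.
Proof.
split; first by move=> z; exact: cvg_id.
by exists 1 => z; rewrite /circle/= => ->.
Qed.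

Lemma bounded_continuous_conj f :
  bounded_continuous f -> bounded_continuous (fun z => (f z)^*).
Proof.
move=> [cf [M fM]]; split.
  by move=> z; apply: continuous_comp; [exact: cf|exact: continuous_conj].
by exists M => z cz; rewrite norm_conjC fM.
Qed.

Lemma bounded_continuousD f g : bounded_continuous f -> bounded_continuous g ->
  bounded_continuous (fun z => f z + g z).
Proof.
move=> [cf [M fM]] [cg [N gN]]; split.
  by move=> z; apply: continuousD; [exact: cf|exact: cg].
exists (M + N) => z cz; apply: le_trans (ler_normD _ _) _.
by rewrite rmorphD lerD ?fM ?gN.
Qed.

Lemma bounded_continuousM f g : bounded_continuous f -> bounded_continuous g ->
  bounded_continuous (fun z => f z * g z).
Proof.
move=> [cf [M fM]] [cg [N gN]]; split.
  by move=> z; apply: continuousM; [exact: cf|exact: cg].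
by exists (M * N) => z cz; rewrite normrM rmorphM ler_pM ?fM ?gN.
Qed.

Lemma bounded_continuous_horner (p : {poly (Cplx R)}) :
  bounded_continuous (fun z => p.[z]).
Proof.
elim/poly_ind: p => [|p c IH].
  have -> : (fun z : Cplx R => 0.[z]) = (fun=> 0).
    by apply/funext => z; rewrite horner0.
  exact: bounded_continuous_cst.
have -> : (fun z => (p * 'X + c%:P).[z]) = (fun z => p.[z] * z + c).
  by apply/funext => z; rewrite hornerD hornerM hornerX hornerC.
apply: bounded_continuousD (bounded_continuous_cst c).
exact: bounded_continuousM IH bounded_continuous_id.
Qed.

Lemma open_measurableC (U : set (borelC R)) : @open (Cplx R) U -> measurable U.
Proof. by move=> oU; exact: sub_gen_smallest. Qed.

Lemma measurable_fun_continuous (D : set (borelC R)) (h : Cplx R -> R) :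
  measurable D -> continuous h -> measurable_fun D (h : borelC R -> R).
Proof.
move=> mD /continuousP ch.
apply: (measurability _ (RGenOpens.measurableE R)).
move=> _ [_ [a [b ->] <-]]; apply: measurableI => //.
by apply: open_measurableC; exact/ch/interval_open.
Qed.

Lemma closed_set1_Cplx (z : Cplx R) : closed [set z].
Proof.
by apply: accessible_closed_set1; apply: hausdorff_accessible; exact: norm_hausdorff.
Qed.

Lemma measurable_circle : measurable (circle : set (borelC R)).
Proof.
rewrite -[circle]setCK; apply: measurableC; apply: open_measurableC.
rewrite openC.
have -> : circle = Num.norm @^-1` [set (1 : Cplx R)] by [].
apply: preimage_closed; last exact: closed_set1_Cplx.
by move=> x _; exact: norm_continuous.
Qed.

Lemma continuous_Re_comp f : continuous f -> continuous (Re \o f).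
Proof.
by move=> cf z; apply: continuous_comp; [exact: cf|exact: continuous_Re].
Qed.
End Analysis.

(** * Integration over the circle *)

Section CircleIntegral.
Variable R : realType.
Variable mu : probability (borelC R) R.
Implicit Types f g : Cplx R -> Cplx R.
Local Notation Re := (@complex.Re R).
Local Notation Im := (@complex.Im R).
Local Notation circle := (@circle R).
Local Notation circle_integral := (@circle_integral R mu).

Lemma integrable_circle (h : Cplx R -> R) (M : R) : continuous h ->
  (forall z, circle z -> `|h z| <= M) ->
  mu.-integrable (circle : set (borelC R)) (EFin \o (h : borelC R -> R)).
Proof.
move=> ch hM; apply: measurable_bounded_integrable.
- exact: measurable_circle.
- apply: (@le_lt_trans _ _ (mu setT)).
    by apply: le_measure; rewrite ?inE//; exact: measurable_circle.
  by rewrite probability_setT ltry.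
- by apply: measurable_fun_continuous => //; exact: measurable_circle.
- exists M; split; first exact: num_real.
  by move=> x Mx z cz; apply: le_trans (hM _ cz) (ltW Mx).
Qed.

Lemma bounded_continuous_Re f : bounded_continuous f ->
  continuous (Re \o f) /\ exists M, forall z, circle z -> `|Re (f z)| <= M.
Proof.
move=> [cf [M fM]]; split; first exact: continuous_Re_comp.
exists M => z cz; rewrite -lecR; apply: le_trans (fM _ cz).
exact: (normc_ge_Re (f z : R[i])).
Qed.

Lemma integrable_Re f : bounded_continuous f ->
  mu.-integrable (circle : set (borelC R)) (EFin \o (fun z : borelC R => Re (f z))).
Proof. by move=> /bounded_continuous_Re[cf [M fM]]; exact: integrable_circle fM. Qed.

Lemma bounded_continuousZ a f : bounded_continuous f ->
  bounded_continuous (fun z => a * f z).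
Proof. by move=> bf; apply: bounded_continuousM => //; exact: bounded_continuous_cst. Qed.

Lemma integrable_Im f : bounded_continuous f ->
  mu.-integrable (circle : set (borelC R)) (EFin \o (fun z : borelC R => Im (f z))).
Proof.
move=> bf; have -> : (fun z : borelC R => Im (f z)) = (fun z => Re (- 'i%C * f z)).
  by apply/funext => z; rewrite Im_Re.
exact: integrable_Re (bounded_continuousZ (- 'i%C) bf).
Qed.

Lemma eq_circle_integral f g : (forall z, circle z -> f z = g z) ->
  circle_integral f = circle_integral g.
Proof.
move=> fg; rewrite /Defs.circle_integral.
by congr (_ +i* _)%C; apply: eq_Rintegral => z; rewrite inE => /fg ->.
Qed.

Lemma circle_integralD f g : bounded_continuous f -> bounded_continuous g ->
  circle_integral (fun z => f z + g z) = circle_integral f + circle_integral g.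
Proof.
move=> bf bg; rewrite /Defs.circle_integral.
have E (z w : Cplx R) : Re (z + w) = Re z + Re w /\ Im (z + w) = Im z + Im w.
  by case: z w => [a b] [c d].
under eq_Rintegral => z _ do rewrite (E _ _).1.
rewrite RintegralD; [|exact: measurable_circle|exact: integrable_Re..].
under [X in (_ +i* X)%C]eq_Rintegral => z _ do rewrite (E _ _).2.
by rewrite RintegralD; [|exact: measurable_circle|exact: integrable_Im..].
Qed.

Lemma circle_integralZ a f : bounded_continuous f ->
  circle_integral (fun z => a * f z) = a * circle_integral f.
Proof.
move=> bf; have mc := @measurable_circle R.
case: a => a b; rewrite /Defs.circle_integral.
have E (z : Cplx R) : Re ((a +i* b)%C * z) = a * Re z + (- b) * Im z /\
    Im ((a +i* b)%C * z) = a * Im z + b * Re z.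
  by case: z => [c d] /=; rewrite mulNr.
have iZ c h : mu.-integrable (circle : set (borelC R)) (EFin \o h) ->
    mu.-integrable (circle : set (borelC R)) (EFin \o (fun z => c * h z)).
  move=> ih; have := integrableZl mc c ih.
  by apply: eq_integrable.
under eq_Rintegral => z _ do rewrite (E _).1.
rewrite RintegralD//; [|by apply: iZ; exact: integrable_Re|by apply: iZ; exact: integrable_Im].
under [X in (_ +i* X)%C]eq_Rintegral => z _ do rewrite (E _).2.
rewrite RintegralD//; [|by apply: iZ; exact: integrable_Im|by apply: iZ; exact: integrable_Re].
rewrite !RintegralZl//; try exact: integrable_Im; try exact: integrable_Re.
by apply/eqP; rewrite eq_complex /= mulNr !eqxx.
Qed.

Lemma circle_integral_conj f : bounded_continuous f ->
  circle_integral (fun z => (f z)^*) = (circle_integral f)^*.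
Proof.
move=> bf; have mc := @measurable_circle R; rewrite /Defs.circle_integral.
have E (z : Cplx R) : Re z^* = Re z /\ Im z^* = -1 * Im z.
  by case: z => a b /=; rewrite mulN1r.
under eq_Rintegral => z _ do rewrite (E _).1.
under [X in (_ +i* X)%C]eq_Rintegral => z _ do rewrite (E _).2.
by rewrite RintegralZl ?mulN1r//; exact: integrable_Im.
Qed.

Lemma circle_integral_real f : (forall z, circle z -> f z \is Num.real) ->
  circle_integral f = (\int[mu]_(z in (circle : set (borelC R))) Re (f z))%:C%C.
Proof.
move=> fr; rewrite /Defs.circle_integral; congr (_ +i* _)%C.
under eq_Rintegral => z.
  rewrite inE => /fr fz; have -> : Im (f z) = 0 by apply: complexI; rewrite (RIm_real fz).
  over.
by rewrite Rintegral_cst ?mul0r//; exact: measurable_circle.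
Qed.

End CircleIntegral.

(** * The inner product of a measure with infinite support *)

Section InnerForm.
Variable R : realType.
Variable mu : probability (borelC R) R.
Local Notation Re := (@complex.Re R).
Local Notation Im := (@complex.Im R).
Local Notation circle := (@circle R).
Implicit Types p q : {poly (Cplx R)}.

Lemma bounded_continuous_inner p q :
  bounded_continuous (fun z => p.[z]^* * q.[z]).
Proof.
apply: bounded_continuousM; last exact: bounded_continuous_horner.
by apply: bounded_continuous_conj; exact: bounded_continuous_horner.
Qed.

Lemma inner_normE p : inner mu p p =
  (\int[mu]_(z in (circle : set (borelC R))) Re (`|p.[z]| ^+ 2))%:C%C.
Proof.
rewrite /inner (@eq_circle_integral _ _ _ (fun z => `|p.[z]| ^+ 2)).
  by rewrite circle_integral_real// => z _; rewrite rpredX// normr_real.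
by move=> z _; rewrite normCK mulrC.
Qed.

Lemma Re_normsq_ge0 (x : Cplx R) : 0 <= Re (`|x| ^+ 2).
Proof. by rewrite -lecR RRe_real ?exprn_ge0// rpredX// normr_real. Qed.

Lemma bounded_continuous_normsq p :
  bounded_continuous (fun z => `|p.[z]| ^+ 2).
Proof.
have -> : (fun z => `|p.[z]| ^+ 2) = (fun z => p.[z]^* * p.[z]).
  by apply/funext => z; rewrite normCK mulrC.
exact: bounded_continuous_inner.
Qed.

Lemma open_horner_neq0 p : open [set z : Cplx R | p.[z] != 0].
Proof.
have -> : [set z : Cplx R | p.[z] != 0] = (fun z => p.[z]) @^-1` (~` [set 0]).
  by apply/seteqP; split => z /= /eqP.
apply: open_comp.
  by move=> z _; exact: (bounded_continuous_horner p).1.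
by rewrite openC; exact: closed_set1_Cplx.
Qed.

(** A nonnegative function of integral 0 vanishes almost everywhere. *)
Lemma inner_eq0_null p : inner mu p p = 0 ->
  mu (circle `&` [set z | p.[z] != 0] : set (borelC R)) = 0%E.
Proof.
rewrite inner_normE => /complexI I0.
have mc := @measurable_circle R.
pose h (z : borelC R) := Re (`|p.[z]| ^+ 2).
have ih : mu.-integrable (circle : set (borelC R)) (EFin \o h).
  exact: integrable_Re (bounded_continuous_normsq p).
have /(ae_eq_integral_abs mu mc (measurable_int mu ih)) :
    (\int[mu]_(x in circle) `|(EFin \o h) x| = 0)%E.
  under eq_integral => x _ do rewrite /= ger0_norm ?Re_normsq_ge0//.
  by rewrite -[LHS]fineK ?[X in X%:E]I0//; exact: integrable_fin_num.
move=> [N [mN N0 subN]].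
apply: (subset_measure0 _ mN _ N0).
  by apply: measurableI => //; apply: open_measurableC; exact: open_horner_neq0.
move=> z [cz pz]; apply: subN => /(_ cz) /= [] /eqP.
have := RRe_real (rpredX 2 (normr_real p.[z])); rewrite -/(h z) => e.
by rewrite -(inj_eq (@complexI R)) e expf_eq0/= normr_eq0 (negPf pz).
Qed.

Lemma finite_roots p : p != 0 -> finite_set [set z | p.[z] = 0].
Proof.
move=> p0; have [r pr] := closed_field_poly_normal p.
apply: (@sub_finite_set _ _ [set` r]); last exact: finite_seq.
move=> z /= /eqP; rewrite -/(root p z) pr rootZ ?lead_coef_eq0//.
by rewrite root_prod_XsubC.
Qed.

Hypothesis mu_circle : mu circle = 1%E.

Lemma circle_setI (A : set (borelC R)) : measurable A -> mu (circle `&` A) = mu A.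
Proof.
move=> mA; have mc := @measurable_circle R.
have c0 : mu (~` circle) = 0%E by rewrite probability_setC// mu_circle subee.
rewrite [RHS](measureDI mu mA mc) [X in _ = (X + _)%E](_ : _ = 0%E) ?add0e ?[RHS]setIC//.
  by rewrite setIC.
apply: (subset_measure0 _ _ _ c0).
- exact: measurableD.
- exact: measurableC.
- by move=> x [].
Qed.

Hypothesis mu_supp : infinite_set (measure_support mu).

(** Positive definiteness is where infinite support enters: if ||p|| = 0 and
   p != 0, the open set where p does not vanish is null, so the support is
   contained in the finite set of roots of p. *)
Lemma circle_form_inner : circle_form (inner mu).
Proof.
split.
- move=> p a q r.
  rewrite -circle_integralZ; last exact: bounded_continuous_inner.
  rewrite -circle_integralD; first last.
  + exact: bounded_continuous_inner.
  + by apply: bounded_continuousZ; exact: bounded_continuous_inner.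
  + apply: eq_circle_integral => z _.
    by rewrite hornerD hornerZ mulrDr mulrCA.
- move=> p q; rewrite /inner -circle_integral_conj; last exact: bounded_continuous_inner.
  by apply: eq_circle_integral => z _; rewrite rmorphM/= conjCK mulrC.
- move=> p p0; rewrite lt_neqAle eq_sym; apply/andP; split; last first.
    by rewrite inner_normE ler0c Rintegral_ge0// => z _; exact: Re_normsq_ge0.
  apply/eqP => /inner_eq0_null.
  have oU := @open_horner_neq0 p.
  rewrite circle_setI; last exact: open_measurableC.
  move=> U0; apply: mu_supp; apply: sub_finite_set (finite_roots p0) => z /= zs.
  apply/eqP/negPn/negP => pz.
  by have := zs _ oU pz; rewrite [X in (_ < X)%E]U0 ltxx.
- move=> p q; apply: eq_circle_integral => z cz.
  rewrite !hornerM hornerX rmorphM/= mulrACA (mulrC z^*).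
  by rewrite -normCK [`|z|]cz expr1n mul1r.
Qed.

End InnerForm.

(** * Orthogonal polynomials of a measure *)

Section Dictionary.
Variable R : realType.
Variable mu : {measure set (borelC R) -> \bar R}.
Hypothesis muP : circle_form (inner mu).

(** The sets over which the definitions of the monic polynomials and of the
   Verblunsky coefficients choose are nonempty, by [szego_step]. *)
Lemma szego_system_measure :
  szego_system (inner mu) (monic_op mu) (verblunsky mu).
Proof.
have opP n : is_monic_op (inner mu) n (monic_op mu n).
  have [p pP] := exists_monic_op muP n.
  exact: (xgetPex 0 (ex_intro [set p | is_monic_op (inner mu) n p] p pP)).
move=> n; split => //.
have [a aP] := szego_step muP (opP n).
by apply: (xgetPex 0 (P := [set a : Cplx R | monic_op mu n.+1 =
    'X * monic_op mu n - a^* *: reversed n (monic_op mu n)])); exists a;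
  exact: (monic_op_unique muP (opP n.+1) aP).
Qed.

Variable (z : Cplx R).
Hypothesis z1 : `|z| = 1.
Local Notation Phi := (monic_op mu).
Local Notation h n := (opnorm2 (inner mu) Phi n).
Local Notation K n := (kernel_diag (inner mu) Phi z n).

Lemma CD_kernel_diagE n : CD_kernel_diag mu n z = K n.+1.
Proof.
apply: eq_bigr => j _; have h0 := opnorm2_gt0 muP szego_system_measure j.
rewrite /orthonormal_op hornerZ normrM exprMn normfV exprVn mulrC.
have -> : `|L2norm mu (Phi j)| = sqrtC (h j) by rewrite ger0_norm// sqrtC_ge0 ltW.
by rewrite sqrtCK.
Qed.

(** The factor (1 - |alpha_n|^2)^(1/2) is ||Phi_(n+1)|| / ||Phi_n||, which turns
   the normalisation of phi_(n+1) into that of phi_n. *)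
Lemma DeltaE gamma n : Delta mu gamma z n =
  ((Phi n.+1).[z])^* * (z ^+ n * ((Phi n).[z])^*) /
  (h n * ((1 - gamma%:C%C) / gamma%:C%C + K n.+1)).
Proof.
have S := szego_system_measure.
have hn := opnorm2_gt0 muP S n; have hn1 := opnorm2_gt0 muP S n.+1.
have a0 : 0 < 1 - `|verblunsky mu n| ^+ 2.
  by move: hn1; rewrite (opnorm2S muP S) pmulr_lgt0.
have sE : sqrtC (h n.+1) = sqrtC (1 - `|verblunsky mu n| ^+ 2) * sqrtC (h n).
  by rewrite (opnorm2S muP S) sqrtCM// nnegrE ltW.
have sr x : 0 < x -> (sqrtC x)^* = sqrtC x :> Cplx R.
  by move=> x0; apply: CrealP; rewrite ger0_real// sqrtC_ge0 ltW.
have s0 x : 0 < x -> sqrtC x != 0 :> Cplx R.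
  by move=> x0; rewrite sqrtC_eq0 gt_eqF.
rewrite /Delta CD_kernel_diagE (_ : ((1 - gamma) * gamma^-1)%:C%C =
  (1 - gamma%:C%C) / gamma%:C%C); last by rewrite rmorphM rmorphB rmorph1 fmorphV.
rewrite (reversed_circle z1); last first.
  by rewrite (leq_trans (size_scale_leq _ _))// (size_op S).
rewrite /orthonormal_op !hornerZ.
rewrite -[L2norm _ (Phi n)]/(sqrtC (h n)) -[L2norm _ (Phi n.+1)]/(sqrtC (h n.+1)).
rewrite !rmorphM !fmorphV /= !sr// sE -[X in _ = _ / (X * _)](sqrtCK (h n)).
rewrite [in RHS]invfM [RHS]mulrA; congr (_ * _).
move: (s0 _ hn) (s0 _ a0); clear.
move: (sqrtC (h n)) (sqrtC _) => x y x0 y0; field; exact/andP.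
Qed.
End Dictionary.

Section PointMassMeasure.
Variable R : realType.
Variables (mu nu : probability (borelC R) R) (zeta : Cplx R) (gamma : R).
Hypotheses (zeta_circle : circle zeta) (gamma_gt0 : 0 < gamma) (gamma_lt1 : gamma < 1).
Hypothesis nuE : forall A : set (borelC R), measurable A ->
      nu A = ((1 - gamma)%:E * mu A + gamma%:E * \d_(zeta : borelC R) A)%E.
Local Notation Re := (@complex.Re R).
Local Notation Im := (@complex.Im R).
Local Notation circle := (@circle R : set (borelC R)).

Lemma integral_point_mass_ge0 (h : Cplx R -> R) : continuous h ->
  (forall z, circle z -> 0 <= h z) ->
  (\int[nu]_(z in circle) (h z)%:E = (1 - gamma)%:E * \int[mu]_(z in circle) (h z)%:E
    + gamma%:E * (h zeta)%:E)%E.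
Proof.
move=> ch h0; have mc := @measurable_circle R.
have g1 : 0 <= 1 - gamma by rewrite subr_ge0 ltW.
pose m1 := mscale (NngNum g1) mu.
pose m2 := mscale (NngNum (ltW gamma_gt0)) (\d_(zeta : borelC R)).
have mh : measurable_fun circle (fun z : borelC R => (h z)%:E).
  by apply/measurable_EFinP; exact: measurable_fun_continuous.
rewrite (eq_measure_integral (measure_add m1 m2)); last first.
  move=> A mA _; rewrite -[LHS]/(nu A) nuE//.
  exact: esym (measure_addE m1 m2 A).
have h0E z : circle z -> (0 <= (h z)%:E)%E by move=> cz; rewrite lee_fin h0.
rewrite ge0_integral_measure_add// !ge0_integral_mscale//.
by rewrite integral_dirac//= diracE mem_set// mul1e.
Qed.

(** Reduces to nonnegative functions by adding the bound M. *)
Lemma Rintegral_point_mass (h : Cplx R -> R) (M : R) : continuous h ->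
  (forall z, circle z -> `|h z| <= M) ->
  \int[nu]_(z in circle) h z =
  (1 - gamma) * (\int[mu]_(z in circle) h z) + gamma * h zeta.
Proof.
have mc := @measurable_circle R.
have pos (k : Cplx R -> R) N : continuous k -> (forall z, circle z -> 0 <= k z) ->
    (forall z, circle z -> `|k z| <= N) -> \int[nu]_(z in circle) k z =
    (1 - gamma) * (\int[mu]_(z in circle) k z) + gamma * k zeta.
  move=> ck k0 kN; rewrite /Rintegral integral_point_mass_ge0//.
  have fm : (\int[mu]_(z in circle) (k z)%:E)%E \is a fin_num.
    by apply: integrable_fin_num => //; exact: (integrable_circle _ ck kN).
  by rewrite fineD ?fineM ?fin_numM.
move=> ch hM; have M0 : 0 <= M by apply: le_trans (hM _ zeta_circle).
have iM (m : probability (borelC R) R) :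
    m.-integrable circle (EFin \o (fun=> M)).
  by apply: (@integrable_circle _ _ (fun=> M) M) => [|z _];
    [exact: cst_continuous|rewrite ger0_norm].
have shift (m : probability (borelC R) R) : \int[m]_(z in circle) h z =
    \int[m]_(z in circle) (h z + M) - \int[m]_(z in circle) M.
  by rewrite (RintegralD mc (integrable_circle m ch hM) (iM m)) addrK.
rewrite !shift (pos (fun z => h z + M) (M + M)).
- rewrite (pos (fun=> M) M); first by ring.
  + exact: cst_continuous.
  + by move=> z _.
  + by move=> z _; rewrite ger0_norm.
- by move=> z; apply: continuousD; [exact: ch|exact: cst_continuous].
- by move=> z cz; rewrite -lerBlDr sub0r; have := hM _ cz; rewrite ler_norml => /andP[].
- by move=> z cz; rewrite (le_trans (ler_normD _ _))// lerD ?hM// ger0_norm.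
Qed.

Lemma inner_point_mass :
  inner nu = point_mass_form (inner mu) zeta (gamma%:C%C : Cplx R).
Proof.
apply/funext => p; apply/funext => q.
have bf := bounded_continuous_inner p q.
have [cR [M RM]] := bounded_continuous_Re bf.
have bf' := bounded_continuousZ (- 'i%C) bf.
have [cI [N IN]] := bounded_continuous_Re bf'.
rewrite /point_mass_form {1}/inner /circle_integral.
rewrite (Rintegral_point_mass cR RM).
under [X in (_ +i* X)%C]eq_Rintegral => z _ do rewrite Im_Re.
rewrite (Rintegral_point_mass cI IN) /= -Im_Re.
under [X in (_ +i* (_ * X + _))%C]eq_Rintegral => z _ do rewrite /= -Im_Re.
rewrite /inner /circle_integral.
move: (_.[_]^* * _) (Rintegral mu _ _) (Rintegral mu _ _) => [a b] x y.
apply/eqP; rewrite eq_complex /=; apply/andP; split; apply/eqP; ring.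
Qed.
End PointMassMeasure.

(** * Polynomials peaking at a point of the circle *)

Lemma measurable_set1_borelC (R : realType) (z : Cplx R) :
  measurable ([set z] : set (borelC R)).
Proof.
rewrite -[[set z]]setCK; apply: measurableC; apply: open_measurableC.
by rewrite openC; exact: closed_set1_Cplx.
Qed.

Section PeakPolynomials.
Variable R : realType.
Variables (mu : probability (borelC R) R) (zeta : Cplx R).
Hypothesis zeta_circle : circle zeta.
Local Notation Re := (@complex.Re R).
Local Notation circle := (@circle R : set (borelC R)).

(** On the circle its modulus is at most 1, with equality only at zeta. *)
Definition peak : {poly (Cplx R)} := 2^-1 *: (zeta^* *: 'X + 1).

Lemma peak_zeta : peak.[zeta] = 1.
Proof.
rewrite !hornerE (mulrC zeta^*) -normCK zeta_circle expr1n.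
by rewrite mulrC divff// pnatr_eq0.
Qed.

Lemma size_peakX n : (size (peak ^+ n) <= n.+1)%N.
Proof.
apply: (leq_trans (size_poly_exp_leq _ _)); rewrite ltnS.
have : (size peak <= 2)%N.
  apply: (leq_trans (size_scale_leq _ _)); apply: (leq_trans (size_polyD _ _)).
  rewrite geq_max size_poly1 andbT.
  by apply: (leq_trans (size_scale_leq _ _)); rewrite size_polyX.
by case: (size peak) => [|[|[|s]]]; rewrite ?mul0n ?mul1n.
Qed.

(** The parallelogram law |1 + w|^2 + |1 - w|^2 = 4 for w = zeta^* z. *)
Lemma peak_normsq z : circle z ->
  `|peak.[z]| ^+ 2 = 1 - `|z - zeta| ^+ 2 / 4.
Proof.
move=> cz; have zz : z * z^* = 1 by exact: circle_conj.
have ww : zeta * zeta^* = 1 by exact: circle_conj.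
rewrite !normCK hornerZ hornerD hornerZ hornerX hornerC.
rewrite !(rmorphM, rmorphD, rmorphB, rmorph1, fmorphV) /= conjCK.
transitivity ((zeta * zeta^*) * (z * z^*) / 4 + 1 / 4 + (zeta^* * z + zeta * z^*) / 4).
  by field.
rewrite zz ww.
transitivity (1 - (z * z^* + zeta * zeta^* - (zeta^* * z + zeta * z^*)) / 4); last by field.
by rewrite zz ww; field.
Qed.

Lemma peak_lt1 z : circle z -> z != zeta -> Re (`|peak.[z]| ^+ 2) < 1.
Proof.
move=> cz zz; rewrite -ltcR RRe_real ?rpredX ?normr_real// peak_normsq//.
by rewrite ltrBlDr ltrDl divr_gt0// exprn_gt0// normr_gt0 subr_eq0.
Qed.

Lemma peak_le1 z : circle z -> Re (`|peak.[z]| ^+ 2) <= 1.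
Proof.
have [->|zz cz] := eqVneq z zeta; last exact/ltW/peak_lt1.
by rewrite peak_zeta normr1 expr1n.
Qed.

Hypothesis mu_zeta : mu [set zeta] = 0%E.

(** Dominated convergence: |peak|^(2 n) is bounded by 1 and tends to 0 off the
   null set {zeta}. *)
Lemma inner_peakX_cvg0 :
  inner mu (peak ^+ n) (peak ^+ n) @[n --> \oo] --> (0 : Cplx R).
Proof.
have mc := @measurable_circle R.
pose s (z : borelC R) := Re (`|peak.[z]| ^+ 2).
have sX n z : Re (`|(peak ^+ n).[z]| ^+ 2) = s z ^+ n.
  have e (x : Cplx R) : (Re (`|x| ^+ 2))%:C%C = `|x| ^+ 2.
    by rewrite RRe_real// rpredX// normr_real.
  apply: complexI; rewrite [RHS]rmorphXn [LHS]e [X in _ = X ^+ n]e.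
  by rewrite horner_exp normrX -!exprM mulnC.
have s0 z : 0 <= s z by exact: Re_normsq_ge0.
have innerE n : inner mu (peak ^+ n) (peak ^+ n) =
    (\int[mu]_(z in circle) s z ^+ n)%:C%C.
  by rewrite inner_normE; congr (_%:C%C); apply: eq_Rintegral => z _; rewrite sX.
have cs n : continuous (fun z : Cplx R => s z ^+ n).
  have -> : (fun z : Cplx R => s z ^+ n) = Re \o (fun z => `|(peak ^+ n).[z]| ^+ 2).
    by apply/funext => z; rewrite -sX.
  exact: continuous_Re_comp (bounded_continuous_normsq _).1.
have lim0 : (\int[mu]_(z in circle) (s z ^+ n)%:E)%E @[n --> \oo] --> 0%E.
  have [|||||_ _] := @dominated_convergence _ _ _ mu _ mc
    (fun n z => (s z ^+ n)%:E) (cst 0%E) (cst 1%E).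
  - by move=> n; apply/measurable_EFinP; exact: measurable_fun_continuous.
  - exact: measurable_cst.
  - exists [set zeta]; split => //; first exact: measurable_set1_borelC.
    move=> z /= nz; apply: contrapT => /eqP zz; apply: nz => cz.
    apply/fine_cvgP; split; first exact: nearW.
    apply: cvg_expr; rewrite ger0_norm//; exact: peak_lt1.
  - by apply: (@integrable_circle _ _ (fun=> 1) 1) => [|z _];
      [exact: cst_continuous|rewrite normr1].
  - apply: nearW => z n cz /=; rewrite lee_fin ger0_norm ?exprn_ge0//.
    by rewrite exprn_ile1// peak_le1.
  - by rewrite integral0.
have {}lim0 : \int[mu]_(z in circle) s z ^+ n @[n --> \oo] --> (0 : R).
  by move/fine_cvgP : lim0 => [].
apply/cvgr0Pnorm_lt => e e0.
have re : e = (Re e)%:C%C by rewrite RRe_real// gtr0_real.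
have e0' : 0 < Re e by rewrite -ltcR -re.
have [N _ HN] := (cvgr0Pnorm_lt _).1 lim0 _ e0'.
exists N => // n Nn /=; rewrite innerE ger0_norm ?ler0c.
  rewrite re ltcR; apply: le_lt_trans (HN n Nn).
  exact: ler_norm.
by apply: Rintegral_ge0 => z _; rewrite exprn_ge0.
Qed.
End PeakPolynomials.

(** * The theorem *)

Theorem theorem2p3 (R : realType) (mu nu : probability (borelC R) R)
    (zeta : Cplx R) (gamma : R) (L : Cplx R)
    (mu_circle : mu (@circle R) = 1%E)
    (mu_supp : infinite_set (measure_support mu))
    (zeta_circle : circle zeta)
    (mu_zeta : mu [set zeta] = 0%E)
    (gamma_gt0 : 0 < gamma) (gamma_lt1 : gamma < 1)
    (nuE : forall A : set (borelC R), measurable A ->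
      nu A = ((1 - gamma)%:E * mu A + gamma%:E * \d_(zeta : borelC R) A)%E)
    (alpha_cvg : zeta ^+ n * verblunsky mu n @[n --> \oo] --> L) :
  zeta ^+ n * Delta mu gamma zeta n @[n --> \oo] --> - 2 * L /\
  zeta ^+ n * verblunsky nu n @[n --> \oo] -->
    - lim (zeta ^+ n * verblunsky mu n @[n --> \oo]).
Proof.
have muP := circle_form_inner mu_circle mu_supp.
have S := szego_system_measure muP.
pose gC : Cplx R := gamma%:C%C.
have g0 : 0 < gC by rewrite ltcR.
have g1 : gC < 1 by rewrite -[1]/(1%:C%C) ltcR.
have c0 : 0 < (1 - gC) / gC by rewrite divr_gt0// subr_gt0.
have Kcvg :
  (kernel_diag (inner mu) (monic_op mu) zeta n.+1)^-1 @[n --> \oo] --> (0 : Cplx R).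
  apply/cvgr0Pnorm_lt => e e0.
  have [N _ HN] := (cvgr0Pnorm_lt _).1 (inner_peakX_cvg0 zeta_circle mu_zeta) _ e0.
  exists N => // n /HN /=; apply: le_lt_trans.
  have Kn := kernel_diag_gt0 muP S zeta n.
  have le := christoffel_min muP S (size_peakX zeta n) (_ : (peak zeta ^+ n).[zeta] = 1).
  rewrite !ger0_norm ?invr_ge0 ?(ltW Kn)//; last exact: form_ge0 muP _.
  by apply: le; rewrite horner_exp peak_zeta// expr1n.
have Dcvg : zeta ^+ n * Delta mu gamma zeta n @[n --> \oo] --> - 2 * L.
  have -> : (fun n => zeta ^+ n * Delta mu gamma zeta n) = (fun n =>
     flux (inner mu) (monic_op mu) zeta n /
       ((1 - gC) / gC + kernel_diag (inner mu) (monic_op mu) zeta n.+1)).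
    apply/funext => n; rewrite (DeltaE muP zeta_circle) /flux invfM.
    by rewrite !mulrA.
  exact: (flux_mean_cvg muP S zeta_circle c0 Kcvg alpha_cvg).
split; first exact: Dcvg.
have nuI := inner_point_mass zeta_circle gamma_gt0 gamma_lt1 nuE.
have nuP : circle_form (inner nu).
  by rewrite nuI; exact: circle_form_point_mass.
have Snu := szego_system_measure nuP; rewrite nuI in Snu.
have -> : (fun n => zeta ^+ n * verblunsky nu n) =
    (fun n => zeta ^+ n * verblunsky mu n + zeta ^+ n * Delta mu gamma zeta n).
  apply/funext => n; rewrite -mulrDr (DeltaE muP zeta_circle).
  by rewrite (point_mass_verblunsky muP zeta_circle g0 g1 S Snu).
rewrite (cvg_lim _ alpha_cvg); last exact: norm_hausdorff.
have -> : - L = L + (- 2 * L) by ring.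
by apply: cvgD; [exact: alpha_cvg|exact: Dcvg].
Qed.
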